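(* Let $0 < \varepsilon < \frac{1}{2} < 1 < C$ be real numbers and $r \geq 2$ an integer. Then there exists $\delta = \delta(r, C, \varepsilon) > 0$ such that the following holds. Let $A_1, \dots, A_r$ be subsets of an abelian group $\mathbf{G}$ with $\lvert A_1 \rvert = \cdots = \lvert A_r \rvert = n$, and let $H \subseteq A_1 \times \cdots \times A_r$ be an $r$-partite $r$-uniform hypergraph with $\lvert E(H) \rvert \geq (1 - \delta)n^r$ and $\left\lvert \bigoplus_H (A_1, \dots, A_r) \right\rvert \leq C n$. Then for each $i\in [r]$ there exists $A'_i \subseteq A_i$ such that (1) $\lvert A_i'\rvert \geq (1 - \varepsilon)n$ for each $i\in [r]$, and (2) $\lvert A_1' + \cdots + A_r'\rvert \leq (C + \varepsilon) n$.
   Context: An $r$-partite $r$-uniform hypergraph $H \subseteq A_1\times\cdots\times A_r$ is a set $E(H)$ of ordered tuples $(a_1,\dots,a_r)$ with $a_i\in A_i$. For such $H$, $\bigoplus_H (A_1, \dots, A_r) \coloneqq \{\sum_{i\in [r]} a_i : (a_1, \dots, a_r) \in E(H)\}$. $A_1'+\cdots+A_r'$ denotes the sumset. *)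

(* Defs.v *)
From mathcomp Require Import all_boot all_order all_algebra finmap reals.

Set Implicit Arguments.
Unset Strict Implicit.
Unset Printing Implicit Defensive.

Import GRing.Theory.
Local Open Scope fset_scope.
Local Open Scope ring_scope.

Section Sums.
Variables (G : zmodType) (r : nat).

(* [H] is the edge set E(H); an edge (a_1, ..., a_r) is the function i |-> a_i,
   with the index set [r] represented by 'I_r. *)
Definition partite_hypergraph (A : 'I_r -> {fset G})
    (H : {fset {ffun 'I_r -> G}}) : Prop :=
  forall a, a \in H -> forall i, a i \in A i.

Definition hypergraph_sum (H : {fset {ffun 'I_r -> G}}) : {fset G} :=
  [fset \sum_(i < r) a i | a : {ffun 'I_r -> G} in H].

Definition addfset (A B : {fset G}) : {fset G} :=
  [fset a + b | a in A, b in B].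

Definition sumset (A : 'I_r -> {fset G}) : {fset G} :=
  \big[addfset/[fset 0]]_(i < r) A i.

End Sums.

Lemma sumsetP (G : zmodType) (r : nat) (A : 'I_r -> {fset G}) (x : G) :
  reflect (exists2 a : {ffun 'I_r -> G},
             forall i, a i \in A i & x = \sum_(i < r) a i)
          (x \in sumset A).
Proof.
rewrite /sumset; apply: (iffP idP).
  elim: r A x => [|r IHr] A x.
    rewrite big_ord0 inE => /eqP ->; exists [ffun=> 0]; first by case.
    by rewrite big_ord0.
  rewrite big_ord_recl => /imfset2P[y /= yA [z /= /IHr[a aA ->] ->]].
  exists [ffun i => oapp a y (unlift ord0 i)].
    by move=> i; rewrite ffunE; case: unliftP => [j|] -> /=.
  rewrite big_ord_recl ffunE unlift_none /=; congr (_ + _).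
  by apply: eq_bigr => i _; rewrite ffunE liftK.
elim: r A x => [|r IHr] A x [a aA ->]; first by rewrite !big_ord0 inE.
rewrite !big_ord_recl; apply/imfset2P; exists (a ord0) => //.
exists (\sum_(i < r) a (lift ord0 i)) => //.
apply: IHr; exists [ffun i => a (lift ord0 i)]; first by move=> i; rewrite ffunE.
by apply: eq_bigr => i _; rewrite ffunE.
Qed.

(* Main.v *)
Require Import Defs.
From mathcomp Require Import all_boot all_order all_algebra finmap reals.
From mathcomp Require Import ring lra.

(** Discarding the few elements of each [A i] that lie in too few edges leaves
    sets [A1 i] whose sumset [W] has size O(n): a sum of popular elements
    [a i] equals [\sum_i s_i - (r - 1) s_0], where [s_0] is the sum of a tuple
    [b] and [s_i] that of [b] with its i-th entry replaced by [a i], and at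
    least half of the [n ^ r] tuples [b] put all these sums in the hypergraph
    sum [S].

    Let [X] be [W] minus [S].  A solution of [a_0 + ... + a_(r-1) = x] with
    [x] in [X] is a non-edge, so there are at most [delta n ^ r] of them.  Each
    solution produces, for every [u] in [A1 0], the closed walk through
    [u - a_0, u, u + a_1, u + a_1 + a_2, ...] in a Cayley-type graph on O(n)
    vertices.  Since there are few closed walks, a removal lemma for closed
    walks of length [r + 1] destroys all of them by deleting few edges; the
    elements of the [A1 i] and of [- X] that label many deleted edges are
    removed, and no solution survives.  The remaining sumset is then contained
    in [S] up to few elements of [X].

    The removal lemma follows from a one-sided regularity lemma (energy
    increment), in which only boxes that are too sparse count as irregular. *)

Set Implicit Arguments.
Unset Strict Implicit.
Unset Printing Implicit Defensive.

Import Order.TTheory GRing.Theory Num.Theory.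
Local Open Scope ring_scope.

(** * Regularity *)

Section FibreAverage.
Variables (R : realType) (U : finType).

(* Zero on an empty fibre. *)
Definition favg (T : finType) (kappa : U -> T) (f : U -> R) (t : T) : R :=
  (\sum_(w | kappa w == t) f w) / #|[pred w | kappa w == t]|%:R.

(** The mean-square density of regularity arguments, without the factor [1 / #|U|]. *)
Definition energy (T : finType) (kappa : U -> T) (f : U -> R) : R :=
  \sum_u favg kappa f (kappa u) ^+ 2.

(** Averaging over fibres is an orthogonal projection: a test function constant on fibres cannot
    tell [f] from its average. *)
Lemma favg_sum (T : finType) (kappa : U -> T) (f h : U -> R) :
    (forall u w, kappa u = kappa w -> h u = h w) ->
  \sum_u h u * favg kappa f (kappa u) = \sum_u h u * f u.
Proof.
move=> hk; rewrite /favg.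
under eq_bigr => u _ do rewrite mulrA mulr_sumr mulr_suml.
rewrite (exchange_big_dep xpredT) //=; apply: eq_bigr => w _.
rewrite (eq_bigr (fun=> h w * f w / #|[pred v | kappa v == kappa w]|%:R)); last first.
  by move=> u /eqP kwu; rewrite (hk u w) // kwu.
rewrite sumr_const -[LHS]mulr_natr -[RHS]mulr1 -mulrA; congr (_ * _).
have -> : #|[pred i | kappa w == kappa i]| = #|[pred v | kappa v == kappa w]|.
  by apply: eq_card => v; rewrite !inE eq_sym.
apply: mulVf; rewrite pnatr_eq0 -lt0n; apply/card_gt0P; exists w.
by rewrite inE.
Qed.

(** Pythagoras: the difference is the squared distance from [f] to its fibre averages. *)
Lemma energy_le (T : finType) (kappa : U -> T) (f : U -> R) :
  energy kappa f <= \sum_u f u ^+ 2.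
Proof.
have E1 : energy kappa f = \sum_u favg kappa f (kappa u) * f u.
  by rewrite -(@favg_sum _ kappa) // => u w ->.
have : 0 <= \sum_u (f u - favg kappa f (kappa u)) ^+ 2.
  by apply: sumr_ge0 => u _; apply: sqr_ge0.
have -> : \sum_u (f u - favg kappa f (kappa u)) ^+ 2 =
    \sum_u f u ^+ 2 - 2 * (\sum_u favg kappa f (kappa u) * f u) + energy kappa f.
  rewrite mulr_sumr -sumrB -big_split /=; apply: eq_bigr => u _; ring.
by rewrite -E1; lra.
Qed.

(** Pythagoras for a finer colouring [kappa']. In particular refining never lowers the energy. *)
Lemma energy_diff (T T' : finType) (kappa : U -> T) (kappa' : U -> T') (f : U -> R) :
    (forall u w, kappa' u = kappa' w -> kappa u = kappa w) ->
  energy kappa' f - energy kappa f =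
  \sum_u (favg kappa' f (kappa' u) - favg kappa f (kappa u)) ^+ 2.
Proof.
move=> ref.
have E1 : energy kappa f = \sum_u favg kappa f (kappa u) * f u.
  by rewrite -(@favg_sum _ kappa) // => u w ->.
have E2 : \sum_u favg kappa f (kappa u) * favg kappa' f (kappa' u) =
          \sum_u favg kappa f (kappa u) * f u.
  by rewrite (@favg_sum _ kappa') // => u w /ref ->.
have -> : \sum_u (favg kappa' f (kappa' u) - favg kappa f (kappa u)) ^+ 2 =
    energy kappa' f
    - 2 * (\sum_u favg kappa f (kappa u) * favg kappa' f (kappa' u)) + energy kappa f.
  rewrite mulr_sumr -sumrB -big_split /=; apply: eq_bigr => u _; ring.
by rewrite E2 -E1; ring.
Qed.

(** Since [Q] is a union of fibres of [kappa'] inside the fibre [t] of [kappa], the change [h] of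
    the averages sums over [Q] to at most [- e * #|Q|%:R]. Expanding [0 <= (h + e) ^+ 2] turns this
    deficit into a gain of energy. *)
Lemma favg_defect (T T' : finType) (kappa : U -> T) (kappa' : U -> T')
    (f : U -> R) (Q : {set U}) (t : T) (e : R) :
    (forall u w, kappa' u = kappa' w -> (u \in Q) = (w \in Q)) ->
    (forall u, u \in Q -> kappa u = t) -> 0 <= e ->
    \sum_(u in Q) f u <= (favg kappa f t - e) * #|Q|%:R ->
  e ^+ 2 * #|Q|%:R <=
  \sum_(u in Q) (favg kappa' f (kappa' u) - favg kappa f (kappa u)) ^+ 2.
Proof.
move=> QP Qt e0 hQ.
pose h u := favg kappa' f (kappa' u) - favg kappa f (kappa u).
have Hs : \sum_(u in Q) h u = \sum_(u in Q) f u - favg kappa f t * #|Q|%:R.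
  rewrite sumrB; congr (_ - _).
    have ind (p : U -> R) : \sum_(u in Q) p u = \sum_u (u \in Q)%:R * p u.
      by rewrite big_mkcond; apply: eq_bigr => u _; case: (u \in Q); rewrite ?mul1r ?mul0r.
    by rewrite !ind favg_sum // => u w /QP ->.
  rewrite (eq_bigr (fun=> favg kappa f t)); last by move=> u /Qt ->.
  by rewrite sumr_const mulr_natr.
have : 0 <= \sum_(u in Q) (h u + e) ^+ 2.
  by apply: sumr_ge0 => u _; apply: sqr_ge0.
have -> : \sum_(u in Q) (h u + e) ^+ 2 =
   \sum_(u in Q) h u ^+ 2 + 2 * e * (\sum_(u in Q) h u) + e ^+ 2 * #|Q|%:R.
  rewrite mulr_natr -sumr_const mulr_sumr -!big_split /=.
  by apply: eq_bigr => u _; ring.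
rewrite Hs -/h => H0.
have : e * (\sum_(u in Q) f u) <= e * ((favg kappa f t - e) * #|Q|%:R).
  exact: ler_wpM2l.
rewrite /h in H0 *; nra.
Qed.

End FibreAverage.

(** * Energy increment for colourings of the vertices *)

Section Regularity.
Variables (R : realType) (V : finType).
Implicit Types (E : rel V) (S Q : {set V}).

Definition edge_ind E (p : V * V) : R := (E p.1 p.2)%:R.

Definition edges E S Q : R := \sum_(p in setX S Q) edge_ind E p.

Definition pair_col (T : finType) (c : V -> T) (p : V * V) : T * T :=
  (c p.1, c p.2).

Definition cell (T : finType) (c : V -> T) (t : T) : {set V} :=
  [set x | c x == t].

Definition sparse_box (T : finType) (c : V -> T) (e : R) E (st : T * T)
    (b : {set V} * {set V}) : bool :=
  [&& b.1 \subset cell c st.1, b.2 \subset cell c st.2,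
      e * #|cell c st.1|%:R <= #|b.1|%:R, e * #|cell c st.2|%:R <= #|b.2|%:R
    & edges E b.1 b.2 <
      (favg (pair_col c) (edge_ind E) st - e) * (#|b.1|%:R * #|b.2|%:R)].

Definition irregular (T : finType) (c : V -> T) (e : R) E (st : T * T) : bool :=
  [exists b, sparse_box c e E st b].

(** A regular pair gets empty sets, which split no cell. *)
Definition box_of (T : finType) (c : V -> T) (e : R) E (st : T * T) :=
  odflt (set0, set0) [pick b | sparse_box c e E st b].

(* Every box witnessing irregularity becomes a union of products of new cells. *)
Definition refine_col (T : finType) (c : V -> T) (k : nat) (e : R)
    (E : nat -> rel V) (x : V) :
    T * {ffun 'I_k * T -> bool} * {ffun 'I_k * T -> bool} :=
  (c x, [ffun p : 'I_k * T => x \in (box_of c e (E p.1) (c x, p.2)).1],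
        [ffun p : 'I_k * T => x \in (box_of c e (E p.1) (p.2, c x)).2]).

Lemma card_pair_col (T : finType) (c : V -> T) st :
  #|[pred p | pair_col c p == st]| = (#|cell c st.1| * #|cell c st.2|)%N.
Proof.
rewrite -cardsX; apply: eq_card => -[x y]; rewrite !inE /pair_col /=.
by case: st => s t; rewrite xpair_eqE.
Qed.

Lemma irregular_box (T : finType) (c : V -> T) e E st :
  irregular c e E st -> sparse_box c e E st (box_of c e E st).
Proof.
by rewrite /box_of => /existsP[b Hb]; case: pickP => //= /(_ b); rewrite Hb.
Qed.

(** A witnessing box fills at least a proportion [e ^+ 2] of its pair of cells, and its average is
    too low by [e]. By [favg_defect] each irregular pair of cells gains [e ^+ 4] times its size. *)
Lemma refine_energy (T : finType) (c : V -> T) (k : nat) (e : R)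
    (E : nat -> rel V) (i : 'I_k) : 0 <= e ->
  e ^+ 4 * #|[set p | irregular c e (E i) (pair_col c p)]|%:R <=
  energy (pair_col (refine_col c k e E)) (edge_ind (E i)) -
  energy (pair_col c) (edge_ind (E i)).
Proof.
move=> e0; set c' := refine_col c k e E.
rewrite energy_diff; last first.
  by move=> [x y] [z w]; rewrite /pair_col /c' /refine_col => -[-> _ _ -> _ _].
rewrite (partition_big (pair_col c) xpredT) //=.
have -> : e ^+ 4 * #|[set p | irregular c e (E i) (pair_col c p)]|%:R =
    \sum_p (if irregular c e (E i) (pair_col c p) then e ^+ 4 else 0).
  rewrite -big_mkcond /= sumr_const mulr_natr; congr (_ *+ _).
  by apply: eq_card => p; rewrite !inE.
rewrite (partition_big (pair_col c) xpredT) //=; apply: ler_sum => st _.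
rewrite (eq_bigr (fun=> if irregular c e (E i) st then e ^+ 4 else 0)); last first.
  by move=> p /eqP ->.
rewrite sumr_const card_pair_col; case: ifP => irr; last first.
  by rewrite mul0rn; apply: sumr_ge0 => p _; apply: sqr_ge0.
have /and5P[sS sQ cS cQ lt] := irregular_box irr.
set b := box_of c e (E i) st in sS sQ cS cQ lt.
have inb p : p \in setX b.1 b.2 -> pair_col c p = st.
  case: p => x y; rewrite inE /= => /andP[/(subsetP sS) + /(subsetP sQ)].
  by rewrite !inE /pair_col /=; case: (st) => s t /= /eqP -> /eqP ->.
apply: (@le_trans _ _ (\sum_(u in setX b.1 b.2)
    (favg (pair_col c') (edge_ind (E i)) (pair_col c' u) -
     favg (pair_col c) (edge_ind (E i)) (pair_col c u)) ^+ 2)); last first.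
  rewrite [leLHS]big_mkcond [leRHS]big_mkcond /=; apply: ler_sum => p _.
  case: ifP => [/inb ->|_]; first by rewrite eqxx.
  by case: ifP => _ //; apply: sqr_ge0.
apply: le_trans (favg_defect (t := st) (e := e) _ inb e0 _); last 2 first.
(* Inside [st] the bits indexed by [(i, st.2)] and [(i, st.1)] decide membership in the box; outside
   [st] both points miss it. *)
- move=> [x y] [z w]; rewrite !inE /pair_col /c' /refine_col /=.
  move=> [cx /ffunP f1 _ cy _ /ffunP f2].
  case exy: (pair_col c (x, y) == st).
    have [cxs cys] : c x = st.1 /\ c y = st.2 by rewrite -(eqP exy).
    have := f1 (i, st.2); have := f2 (i, st.1); rewrite !ffunE /= -cx -cy.
    by rewrite cxs cys -surjective_pairing => -> ->.
  have nb u v : pair_col c (u, v) != st -> (u \in b.1) && (v \in b.2) = false.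
    by move=> ne; apply: contraNF ne => uv; rewrite inb // inE.
  have ezw : pair_col c (z, w) == st = false by rewrite -exy /pair_col /= cx cy.
  by rewrite !nb ?exy ?ezw.
- by rewrite cardsX natrM ltW.
rewrite cardsX -[leLHS]mulr_natr !natrM.
have : e * #|cell c st.1|%:R * (e * #|cell c st.2|%:R) <= #|b.1|%:R * #|b.2|%:R :> R.
  by apply: ler_pM => //; apply: mulr_ge0.
move/(ler_wpM2l (sqr_ge0 e)); apply: le_trans; rewrite le_eqVlt; apply/orP; left.
by apply/eqP; ring.
Qed.

Definition regular_col (T : finType) (c : V -> T) (k : nat) (e : R)
    (E : nat -> rel V) : bool :=
  [forall i : 'I_k, #|[set p | irregular c e (E i) (pair_col c p)]|%:R
                    <= e * #|V|%:R ^+ 2].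

Definition total_energy (T : finType) (c : V -> T) (k : nat)
    (E : nat -> rel V) : R :=
  \sum_(i < k) energy (pair_col c) (edge_ind (E i)).

Lemma total_energy_le (T : finType) (c : V -> T) (k : nat) (E : nat -> rel V) :
  total_energy c k E <= k%:R * #|V|%:R ^+ 2.
Proof.
rewrite mulr_natl -[X in _ *+ X]card_ord -sumr_const; apply: ler_sum => i _.
apply: le_trans (energy_le _ _) _.
apply: (@le_trans _ _ (\sum_(p : V * V) 1)); last first.
  by rewrite sumr_const card_prod -[leLHS]/(_%:R) natrM.
apply: ler_sum => p _; rewrite /edge_ind; case: (E i _ _); rewrite ?expr1n //.
by rewrite expr0n.
Qed.

Fixpoint col_bound (k j : nat) : nat :=
  if j is j'.+1 then (col_bound k j' * 2 ^ (k * col_bound k j')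
                      * 2 ^ (k * col_bound k j'))%N else 1%N.

(** If some [E i] fails, more than [e * #|V|%:R ^+ 2] pairs are irregular for it, so refining gains
    [e ^+ 5 * #|V|%:R ^+ 2]; the energies of the other relations do not drop. *)
Lemma energy_iteration (k : nat) (e : R) (E : nat -> rel V) (j : nat) : 0 <= e ->
  exists (T : finType) (c : V -> T), (#|T| <= col_bound k j)%N /\
    (regular_col c k e E \/ j%:R * e ^+ 5 * #|V|%:R ^+ 2 <= total_energy c k E).
Proof.
move=> e0; elim: j => [|j [T [c [cT IH]]]].
  exists unit, (fun=> tt); rewrite card_unit; split=> //; right.
  rewrite mul0r mul0r; apply: sumr_ge0 => i _; apply: sumr_ge0 => u _.
  exact: sqr_ge0.
have le_col : (col_bound k j <= col_bound k j.+1)%N.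
  by rewrite /= -mulnA leq_pmulr // muln_gt0 !expn_gt0.
have [reg|nreg] := boolP (regular_col c k e E).
  by exists T, c; split; [apply: leq_trans le_col | left].
case: IH => [reg|IH]; first by rewrite reg in nreg.
exists [the finType of (T * {ffun 'I_k * T -> bool} * {ffun 'I_k * T -> bool})%type],
  (refine_col c k e E); split.
  rewrite !card_prod !card_ffun card_bool card_prod card_ord /=.
  by apply: leq_mul; [apply: leq_mul => // |];
     rewrite leq_exp2l // leq_mul2l cT orbT.
right; move: nreg; rewrite negb_forall => /existsP[i]; rewrite -ltNge => irr.
have inc : e ^+ 5 * #|V|%:R ^+ 2 <=
    total_energy (refine_col c k e E) k E - total_energy c k E.
  rewrite -sumrB (bigD1 i) //= -[leLHS]addr0; apply: lerD; last first.
    apply: sumr_ge0 => l _; apply: le_trans (refine_energy _ _ _ e0).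
    by apply: mulr_ge0 => //; apply: exprn_ge0.
  apply: le_trans (refine_energy _ _ _ e0); rewrite exprSr -mulrA.
  by apply: ler_wpM2l; [apply: exprn_ge0 | apply: ltW].
rewrite -natr1 mulrDl mulrDl mul1r; lra.
Qed.

End Regularity.

(** One colouring serves all [k] relations. More than [k%:R / e ^+ 5] increments would push the
    total energy above [k%:R * #|V|%:R ^+ 2]. *)
Lemma regularity (R : realType) (k : nat) (e : R) : 0 < e ->
  exists M : nat, forall (V : finType) (E : nat -> rel V),
  exists (T : finType) (c : V -> T), (#|T| <= M)%N /\ regular_col c k e E.
Proof.
move=> e0; set x := k%:R / e ^+ 5.
exists (col_bound k (Num.truncn x).+1) => V E.
have e50 : 0 < e ^+ 5 by apply: exprn_gt0.
have [T [c [cT [reg|en]]]] := energy_iteration k E (Num.truncn x).+1 (ltW e0).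
  by exists T, c.
exists T, c; split=> //.
have [V0|Vn0] := posnP #|V|.
  apply/forallP => i; rewrite V0 expr0n mulr0 lern0 -leqn0.
  by apply: leq_trans (max_card _) _; rewrite card_prod V0.
have := le_trans en (total_energy_le R c k E).
rewrite ler_pM2r; last by rewrite exprn_gt0 // ltr0n.
by rewrite -ler_pdivlMr // -/x leNgt truncnS_gt.
Qed.

(** * Removal of closed walks *)

Section Walks.
Variables (R : realType) (V : finType).
Implicit Types (E : nat -> rel V) (S Q X Y : {set V}).

Fixpoint walks E (m i : nat) (u w : V) : R :=
  if m is m'.+1 then \sum_v (E i u v)%:R * walks E m' i.+1 v w else (u == w)%:R.

Lemma walks_ge0 E m i u w : 0 <= walks E m i u w.
Proof.
elim: m i u => [|m IH] i u /=; first exact: ler0n.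
by apply: sumr_ge0 => v _; apply: mulr_ge0.
Qed.

Lemma walks_recr E m i u w :
  walks E m.+1 i u w = \sum_v walks E m i u v * (E (i + m)%N v w)%:R.
Proof.
elim: m i u => [|m IH] i u.
  rewrite /= addn0 (bigD1 w) //= eqxx mulr1 big1 ?addr0; last first.
    by move=> v /negPf ->; rewrite mulr0.
  rewrite (bigD1 u) //= eqxx mul1r big1 ?addr0 // => v.
  by rewrite eq_sym => /negPf ->; rewrite mul0r.
rewrite -[LHS]/(\sum_v (E i u v)%:R * walks E m.+1 i.+1 v w).
under eq_bigr => v _ do rewrite IH mulr_sumr.
rewrite exchange_big /=; apply: eq_bigr => v _.
by rewrite mulr_suml addSnnS; apply: eq_bigr => z _; rewrite mulrA.
Qed.

Lemma edgesE (E : rel V) X Y :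
  edges R E X Y = \sum_(x in X) \sum_(y in Y) (E x y)%:R.
Proof.
rewrite /edges pair_big /=; apply: eq_bigl => -[x y] /=.
by rewrite inE.
Qed.

(** What a regular pair of average at least [3 * e] provides, and all that the count of walks
    uses. *)
Definition dense (e : R) (E : rel V) S Q : bool :=
  [forall X : {set V}, forall Y : {set V},
     [&& X \subset S, Y \subset Q, e * #|S|%:R <= #|X|%:R & e * #|Q|%:R <= #|Y|%:R]
       ==> (2 * e * #|X|%:R * #|Y|%:R <= edges R E X Y)].

Lemma denseP e (E : rel V) S Q X Y : dense e E S Q ->
    X \subset S -> Y \subset Q ->
    e * #|S|%:R <= #|X|%:R -> e * #|Q|%:R <= #|Y|%:R ->
  2 * e * #|X|%:R * #|Y|%:R <= edges R E X Y.
Proof.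
by move=> /forallP/(_ X)/forallP/(_ Y)/implyP H XS YQ cX cY; apply: H; apply/and4P.
Qed.

Lemma dense_tr e (E : rel V) S Q : dense e E S Q -> dense e (fun y x => E x y) Q S.
Proof.
move=> D; apply/forallP => Y; apply/forallP => X; apply/implyP => /and4P[YQ XS cY cX].
rewrite edgesE exchange_big -edgesE; apply: le_trans (denseP D XS YQ cX cY).
by rewrite mulrAC.
Qed.

(** Too many vertices of low degree would form, with [X], a large box with too few edges. *)
Lemma dense_low_degree e (E : rel V) S Q X : 0 <= e -> dense e E S Q ->
    X \subset S -> e * #|S|%:R <= #|X|%:R ->
  #|[set y in Q | \sum_(x in X) (E x y)%:R < 2 * e * #|X|%:R]|%:R <= e * #|Q|%:R.
Proof.
move=> e0 D XS cX; set Y := [set y in Q | _]; rewrite leNgt; apply/negP => ltY.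
have YQ : Y \subset Q by apply/subsetP => y; rewrite inE => /andP[].
have := denseP D XS YQ cX (ltW ltY); apply/negP; rewrite -ltNge.
rewrite edgesE exchange_big /= [ltRHS]mulr_natr -sumr_const.
(* The strict inequality between the two sums over [Y] needs at least one term. *)
have [y yY] : exists y, y \in Y.
  apply/set0Pn; apply: contraTneq ltY => ->; rewrite cards0 -leNgt.
  exact: mulr_ge0.
rewrite (bigD1 y) //= [ltRHS](bigD1 y) //=; apply: ltr_leD.
  by move: yY; rewrite inE => /andP[].
by apply: ler_sum => z /andP[+ _]; rewrite inE => /andP[_ /ltW].
Qed.

(** Induction on the length: most vertices of [C i.+1] have at least [2 * e * #|X|%:R] predecessors
    in [X], and they again form a large set. Each of the [m.+2] vertices of a walk contributes the
    crude factor [e ^+ 2 * b]. *)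
Lemma walks_between E (C : nat -> {set V}) (e b : R) m i X Y :
    0 < e -> e <= 1 / 4 -> 0 <= b ->
    (forall j, (i <= j <= i + m)%N -> dense e (E j) (C j) (C j.+1)) ->
    (forall j, (i <= j <= i + m.+1)%N -> b <= #|C j|%:R) ->
    X \subset C i -> Y \subset C (i + m.+1)%N ->
    e * #|C i|%:R <= #|X|%:R -> e * #|C (i + m.+1)%N|%:R <= #|Y|%:R ->
  (e ^+ 2 * b) ^+ m.+2 <= \sum_(u in X) \sum_(w in Y) walks E m.+1 i u w.
Proof.
move=> e0 e4 b0; set a := e ^+ 2 * b.
have aC j : b <= #|C j|%:R -> a <= e * #|C j|%:R.
  move=> bC; rewrite /a expr2 -mulrA ler_pM2l //; apply: le_trans bC.
  by rewrite ler_piMl //; lra.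
have a0 : 0 <= a by apply: mulr_ge0 => //; apply: sqr_ge0.
have aX j S : b <= #|C j|%:R -> e * #|C j|%:R <= #|S|%:R -> a <= 2 * e * #|S|%:R.
  move=> bC cS; rewrite /a.
  have : e * (e * #|C j|%:R) <= e * #|S|%:R by rewrite ler_pM2l.
  have : e * (e * b) <= e * (e * #|C j|%:R) by rewrite !ler_pM2l.
  rewrite expr2 -!mulrA.
  have : 0 <= e * #|S|%:R by apply: mulr_ge0 => //; exact: ltW.
  lra.
elim: m i X => [|m IH] i X Hd Hb XC YC cX cY.
  rewrite (eq_bigr (fun u => \sum_(w in Y) (E i u w)%:R)); last first.
    move=> u _; apply: eq_bigr => w _ /=.
    rewrite (bigD1 w) //= eqxx mulr1 big1 ?addr0 // => v /negPf ->.
    by rewrite mulr0.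
  rewrite -edgesE; rewrite addn1 in YC cY Hb.
  apply: le_trans (denseP (Hd i _) XC YC cX cY); last by rewrite addn0 leqnn.
  rewrite expr2; apply: ler_pM => //.
    by apply: (aX i) => //; apply: Hb; rewrite leqnn leqnSn.
  by apply: le_trans cY; apply: aC; apply: Hb; rewrite leqnSn leqnn.
have dC1 : dense e (E i) (C i) (C i.+1) by apply: Hd; rewrite leqnn leq_addr.
have := dense_low_degree (ltW e0) dC1 XC cX; set L := [set y in _ | _] => cL.
pose X' := C i.+1 :\: L.
have LC : L \subset C i.+1 by apply/subsetP => y; rewrite inE => /andP[].
have cX' : e * #|C i.+1|%:R <= #|X'|%:R.
  have : #|X'|%:R = #|C i.+1|%:R - #|L|%:R :> R.
    by rewrite -(cardsID L (C i.+1)) (setIidPr LC) natrD addrC addKr.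
  move=> ->; have : e * #|C i.+1|%:R <= 1 / 4 * #|C i.+1|%:R by apply: ler_wpM2r.
  have : 0 <= #|C i.+1|%:R :> R by []. 
  lra.
have -> : \sum_(u in X) \sum_(w in Y) walks E m.+2 i u w =
   \sum_v (\sum_(u in X) (E i u v)%:R) * \sum_(w in Y) walks E m.+1 i.+1 v w.
  under [RHS]eq_bigr => v _ do rewrite mulr_suml.
  rewrite [RHS]exchange_big /=; apply: eq_bigr => u _.
  under [RHS]eq_bigr => v _ do rewrite mulr_sumr.
  by rewrite exchange_big.
have w0 v : 0 <= \sum_(w in Y) walks E m.+1 i.+1 v w.
  by apply: sumr_ge0 => w _; apply: walks_ge0.
apply: (@le_trans _ _ (\sum_(v in X') 2 * e * #|X|%:R
            * \sum_(w in Y) walks E m.+1 i.+1 v w)); last first.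
  rewrite [leLHS]big_mkcond; apply: ler_sum => v _.
  case: ifP => [|_]; last by apply: mulr_ge0 => //; apply: sumr_ge0.
  rewrite !inE negb_and -leNgt andbC => /andP[vC /orP[/negP//|dv]].
  exact: (ler_wpM2r (w0 v) dv).
rewrite -mulr_sumr exprS; apply: ler_pM => //; first exact: exprn_ge0.
  by apply: (aX i) => //; apply: Hb; rewrite leqnn leq_addr.
apply: IH => //.
- by move=> j /andP[ij jm]; apply: Hd; rewrite (ltnW ij) addnS.
- by move=> j /andP[ij jm]; apply: Hb; rewrite (ltnW ij) -addSnnS.
- by apply: subsetDl.
- by rewrite addSnnS.
- by rewrite addSnnS.
Qed.

(** At least half of the vertices of [C 0] have many successors in [C 1] and many predecessors in
    [C m.+2]; walks between these two neighbourhoods close up. The length [m.+3] leaves [m.+1] steps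
    between them, as [walks_between] requires. *)
Lemma closed_walks_lower E (C : nat -> {set V}) (e b : R) m :
    0 < e -> e <= 1 / 4 -> 0 <= b ->
    (forall j, (j < m.+3)%N -> dense e (E j) (C j) (C j.+1)) ->
    (forall j, (j < m.+3)%N -> b <= #|C j|%:R) -> C m.+3 = C 0%N ->
  (e ^+ 2 * b) ^+ m.+3 <= \sum_u walks E m.+3 0 u u.
Proof.
move=> e0 e4 b0 Hd Hb C0; set a := e ^+ 2 * b.
have a0 : 0 <= a by apply: mulr_ge0 => //; apply: sqr_ge0.
have e1 S : e * #|S|%:R <= #|S|%:R.
  by rewrite ler_piMl //; lra.
have lo := dense_low_degree (ltW e0) (dense_tr (Hd 0%N isT)) (subxx _) (e1 _).
have li := dense_low_degree (ltW e0) (Hd m.+2 (leqnn _)) (subxx _) (e1 _).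
rewrite C0 in li.
set Lo := [set y in _ | _] in lo; set Li := [set y in _ | _] in li.
pose D := C 0%N :\: (Lo :|: Li).
have cD : 1 / 2 * #|C 0%N|%:R <= #|D|%:R :> R.
  have : (#|C 0%N| <= #|D| + (#|Lo| + #|Li|))%N.
    rewrite -(cardsID (Lo :|: Li) (C 0%N)) addnC leq_add2l.
    apply: leq_trans (subset_leq_card (subsetIr _ _)) _.
    by rewrite cardsU leq_subr.
  rewrite -(ler_nat R) !natrD.
  have : e * #|C 0%N|%:R <= 1 / 4 * #|C 0%N|%:R by apply: ler_wpM2r.
  move: lo li; lra.
apply: (@le_trans _ _ (\sum_(u in D) a ^+ m.+2)).
  rewrite sumr_const -[leRHS]mulr_natr exprSr; apply: ler_wpM2l; first exact: exprn_ge0.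
  apply: le_trans cD; have := Hb 0%N isT.
  have : a <= 1 / 2 * b.
    rewrite /a; apply: ler_wpM2r => //; rewrite expr2.
    have : e * e <= 1 / 4 * 1 by apply: ler_pM => //; lra.
    lra.
  lra.
rewrite [leLHS]big_mkcond; apply: ler_sum => u _; case: ifP => [|_]; last first.
  exact: walks_ge0.
rewrite !inE negb_or !negb_and -!leNgt => /andP[/andP[/orP[/negP//|du1] /orP[/negP//|du2]] uC].
pose X := [set v in C 1%N | E 0%N u v]; pose Y := [set v in C m.+2 | E m.+2 v u].
have deg (S : {set V}) (p : pred V) : \sum_(x in S) (p x)%:R = #|[set v in S | p v]|%:R :> R.
  rewrite -sum1_card natr_sum big_mkcond [RHS]big_mkcond /=; apply: eq_bigr => v _.
  by rewrite inE; case: (v \in S); case: (p v).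
rewrite !deg in du1 du2.
have -> : walks E m.+3 0 u u =
    \sum_v \sum_w (E 0%N u v)%:R * walks E m.+1 1 v w * (E m.+2 w u)%:R.
  rewrite -[LHS]/(\sum_v (E 0%N u v)%:R * walks E m.+2 1 v u).
  apply: eq_bigr => v _; rewrite walks_recr mulr_sumr.
  by apply: eq_bigr => w _; rewrite mulrA.
apply: (@le_trans _ _ (\sum_(v in X) \sum_(w in Y) walks E m.+1 1 v w)).
  have half S Z : 2 * e * #|S|%:R <= (#|Z|%:R : R) -> e * #|S|%:R <= #|Z|%:R.
    apply: le_trans; rewrite -mulrA.
    have : 0 <= e * #|S|%:R by apply: mulr_ge0 => //; exact: ltW.
    lra.
  apply: (@walks_between E C e b) => //.
  - by move=> j /andP[_ jm]; apply: Hd; rewrite add1n in jm; apply: leq_trans jm _.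
  - by move=> j /andP[_ jm]; apply: Hb; rewrite add1n in jm.
  - by apply/subsetP => v; rewrite inE => /andP[].
  - by apply/subsetP => v; rewrite inE => /andP[].
  - exact: half.
  - exact: half.
rewrite big_mkcond; apply: ler_sum => v _.
have t0 w : 0 <= (E 0%N u v)%:R * walks E m.+1 1 v w * (E m.+2 w u)%:R :> R.
  by rewrite !mulr_ge0 // walks_ge0.
case: ifP => [|_]; last exact: sumr_ge0.
rewrite inE => /andP[_ ->]; rewrite big_mkcond; apply: ler_sum => w _.
case: ifP => [|_]; last by rewrite !mulr_ge0 // walks_ge0.
by rewrite inE => /andP[_ ->]; rewrite mul1r mulr1.
Qed.

End Walks.

(** * Cleaning the edges along a regular colouring *)

Section Removal.
Variables (R : realType) (V : finType).

(** A large box loses at most [e] of the average [3 * e], which leaves [2 * e]. *)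
Lemma dense_regular (T : finType) (c : V -> T) (e : R) (E : rel V) st :
    ~~ irregular c e E st -> 3 * e <= favg (pair_col c) (edge_ind R E) st ->
  dense e E (cell c st.1) (cell c st.2).
Proof.
move=> nirr d3; apply/forallP => X; apply/forallP => Y; apply/implyP.
move=> /and4P[XS YQ cX cY]; rewrite leNgt; apply: contra nirr => lt.
apply/existsP; exists (X, Y); apply/and5P; split=> //=; apply: lt_le_trans lt _.
rewrite -mulrA; apply: ler_wpM2r; first exact: mulr_ge0.
lra.
Qed.

Lemma card_small_cells (T : finType) (c : V -> T) (b : R) :
  #|[set x | #|cell c (c x)|%:R < b]|%:R <= #|T|%:R * Num.max b 0.
Proof.
rewrite -sum1_card natr_sum (partition_big c xpredT) //= mulr_natl -sumr_const.
apply: ler_sum => t _.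
have [lt|ge] := ltP #|cell c t|%:R b; last first.
  rewrite big1 ?le_max ?lexx ?orbT // => x; rewrite inE => /andP[+ /eqP xt].
  by rewrite xt ltNge ge.
rewrite le_max; apply/orP; left; apply: le_trans (ltW lt).
rewrite -natr_sum ler_nat sum1_card; apply: subset_leq_card.
by apply/subsetP => x; rewrite !inE => /andP[].
Qed.

(** By [favg_sum] the edge indicator may be replaced by its fibre average, which is below [d]
    wherever it is counted. *)
Lemma card_low_density (T : finType) (c : V -> T) (E : rel V) (d : R) : 0 <= d ->
  #|[set p | E p.1 p.2 && (favg (pair_col c) (edge_ind R E) (pair_col c p) < d)]|%:R
  <= d * #|V|%:R ^+ 2.
Proof.
move=> d0; set g := favg _ _.
have -> : #|[set p | E p.1 p.2 && (g (pair_col c p) < d)%R]|%:R =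
    \sum_p (g (pair_col c p) < d)%R%:R * edge_ind R E p.
  rewrite -sum1_card natr_sum big_mkcond; apply: eq_bigr => p _.
  by rewrite inE /edge_ind; case: (E _ _); case: (_ < _); rewrite ?mulr1 ?mulr0 ?mul0r.
rewrite -(@favg_sum _ _ _ (pair_col c)); last by move=> u w ->.
have -> : d * #|V|%:R ^+ 2 = \sum_(p : V * V) d.
  by rewrite sumr_const card_prod -[RHS]mulr_natr natrM expr2.
apply: ler_sum => p _; rewrite -/g; case: ltP => [/ltW|_]; rewrite ?mul1r ?mul0r //.
Qed.

End Removal.

(** The deleted edges lie in irregular pairs, in pairs of low density, or at small cells. A
    surviving closed walk runs through large cells joined by dense pairs, and [closed_walks_lower]
    then gives too many closed walks in [E]. *)
Lemma closed_walk_removal (R : realType) (m : nat) (eps : R) : 0 < eps ->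
  exists2 delta : R, 0 < delta & forall (V : finType) (E : nat -> rel V),
    \sum_u walks R E m.+3 0 u u <= delta * #|V|%:R ^+ m.+3 ->
  exists2 E' : nat -> rel V,
    forall i, (i < m.+3)%N ->
      #|[set p | E i p.1 p.2 && ~~ E' i p.1 p.2]|%:R <= eps * #|V|%:R ^+ 2
  & forall v : nat -> V, v m.+3 = v 0%N ->
      ~ (forall i, (i < m.+3)%N -> E' i (v i) (v i.+1)).
Proof.
(* Irregular pairs cost [e], low density [3 * e], small cells [e] at each endpoint: [6 * e] in
   all. *)
move=> eps0; pose e := Num.min (eps / 6) (1 / 4).
have e0 : 0 < e by rewrite lt_min; apply/andP; split; lra.
have e4 : e <= 1 / 4 by rewrite ge_min lexx orbT.
have e6 : 6 * e <= eps by have : e <= eps / 6 by [rewrite ge_min lexx]; lra.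
have [M reg] := regularity m.+3 e0.
(* At most [M] cells smaller than [beta * N] cover at most [e * N] vertices. *)
pose beta := e / M.+1%:R.
have b0 : 0 < beta by apply: divr_gt0 => //; rewrite ltr0n.
have eb0 : 0 < e ^+ 2 * beta by apply: mulr_gt0 => //; apply: exprn_gt0.
exists ((e ^+ 2 * beta) ^+ m.+3 / 2) => [|V E cnt].
  by apply: divr_gt0 => //; apply: exprn_gt0.
have [T [c [cT /forallP regc]]] := reg V E.
set N : R := #|V|%:R in cnt regc *.
have N0 : 0 <= N by apply: ler0n.
(* This [E'] is a union of products of cells and need not lie in [E]: a walk in it serves only to
   select cells. *)
exists (fun i x y => [&& dense e (E i) (cell c (c x)) (cell c (c y)),
    beta * N <= #|cell c (c x)|%:R & beta * N <= #|cell c (c y)|%:R]).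
  move=> i im.
  pose sm := [set x | #|cell c (c x)|%:R < beta * N].
  have csm : #|sm|%:R <= e * N.
    apply: le_trans (card_small_cells c (beta * N)) _.
    rewrite max_l; last by rewrite mulr_ge0 // ltW.
    rewrite mulrA; apply: ler_wpM2r => //; rewrite /beta mulrCA ler_piMr ?(ltW e0) //.
    rewrite ler_pdivrMr ?ltr0n // mul1r ler_nat; exact: leq_trans cT (leqnSn _).
  pose irr := [set p | irregular c e (E i) (pair_col c p)].
  pose low := [set p | E i p.1 p.2
    && (favg (pair_col c) (edge_ind R (E i)) (pair_col c p) < 3 * e)].
  have cirr : #|irr|%:R <= e * N ^+ 2 by have := regc (Ordinal im).
  have clow : #|low|%:R <= 3 * e * N ^+ 2 by apply: card_low_density; lra.
  apply: (@le_trans _ _ (#|irr|%:R + #|low|%:R + #|setX sm [set: V]|%:R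
                         + #|setX [set: V] sm|%:R)).
    rewrite -!natrD ler_nat.
    apply: (@leq_trans #|irr :|: low :|: setX sm setT :|: setX setT sm|); last first.
      do 3!(apply: leq_trans (leq_card_setU _ _) _; rewrite ?leq_add2r //).
    apply: subset_leq_card; apply/subsetP => p; rewrite !inE andbT.
    case/andP=> Ep; apply: contraR; rewrite !negb_or !negb_and -!leNgt Ep /=.
    rewrite ?orbF => /andP[/andP[/andP[nirr d3]] -> ->]; rewrite !andbT.
    exact: dense_regular nirr d3.
  rewrite !cardsX cardsT !natrM -/N.
  have : #|sm|%:R * N <= e * N * N by apply: ler_wpM2r.
  have : 6 * e * N ^+ 2 <= eps * N ^+ 2 by apply: ler_wpM2r => //; apply: exprn_ge0.
  move: cirr clow; rewrite [N * _]mulrC expr2 -!mulrA; lra.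
move=> v vk H; have Npos : 0 < N by rewrite ltr0n; apply/card_gt0P; exists (v 0%N).
have := @closed_walks_lower R V E (fun i => cell c (c (v i))) e (beta * N) m e0 e4.
move/(_ (mulr_ge0 (ltW b0) N0)) => L.
have : (e ^+ 2 * beta) ^+ m.+3 * N ^+ m.+3 <= (e ^+ 2 * beta) ^+ m.+3 * N ^+ m.+3 / 2.
  rewrite [leRHS]mulrAC -[leLHS]exprMn -[X in X ^+ _ <= _]mulrA.
  apply: le_trans cnt; apply: L; last by rewrite vk.
    by move=> j /H /and3P[].
  by move=> j /H /and3P[].
have : 0 < (e ^+ 2 * beta) ^+ m.+3 * N ^+ m.+3 by apply: mulr_gt0; apply: exprn_gt0.
lra.
Qed.

Local Open Scope fset_scope.
Local Open Scope ring_scope.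

(** * Cayley graphs *)

Definition cayley (G : zmodType) (V : {fset G}) (D : nat -> {fset G}) (i : nat) :
    rel V := fun x y => val y - val x \in D i.
Arguments cayley {G} V D.

Lemma sum_card_fibres (K : choiceType) (T : finType) (f : T -> K) (S : {set T})
    (X : {fset K}) :
  (\sum_(d <- X) #|[set p in S | f p == d]| <= #|S|)%N.
Proof.
under eq_bigr => d _ do rewrite -sum1_card big_mkcond /=.
rewrite exchange_big /= -sum1_card [leqRHS]big_mkcond /=; apply: leq_sum => p _.
under eq_bigr => d _ do rewrite inE.
case: (p \in S) => /=; last by rewrite big1.
rewrite -big_mkcond /= sum1_count.
rewrite (eq_count (a2 := pred1 (f p))); last by move=> d; rewrite /= eq_sym.
by rewrite count_uniq_mem ?fset_uniq // leq_b1.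
Qed.

(** A label is dropped when more than [theta] times the size of [V] of its edges are deleted. If a
    zero-sum sequence survives, each start in [Z] gives a closed walk, which uses a deleted edge; at
    a given step distinct starts use distinct edges, so [Z] is small. *)
Lemma cayley_removal (R : realType) (m : nat) (eps theta : R) :
    0 < eps -> 0 < theta ->
  exists2 delta : R, 0 < delta &
  forall (G : zmodType) (V : {fset G}) (D : nat -> {fset G}),
    \sum_u walks R (cayley V D) m.+3 0 u u <= delta * #|` V|%:R ^+ m.+3 ->
  exists D' : nat -> {fset G},
    [/\ forall i, D' i `<=` D i,
        forall i, (i < m.+3)%N -> #|` D i `\` D' i|%:R <= eps * #|` V|%:R
      & forall (d : nat -> G) (Z : {fset G}),
          (forall i, (i < m.+3)%N -> d i \in D' i) -> \sum_(i < m.+3) d i = 0 ->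
          (forall z j, z \in Z -> (j < m.+3)%N -> z + \sum_(i < j) d i \in V) ->
        #|` Z|%:R <= m.+3%:R * (theta * #|` V|%:R)].
Proof.
move=> eps0 th0; have [delta d0 rem] := closed_walk_removal m (mulr_gt0 eps0 th0).
exists delta => // G V D; rewrite cardfE => /rem[E' cE' nE'].
pose bad i := [set p : V * V | cayley V D i p.1 p.2 && ~~ E' i p.1 p.2].
pose B i d := [set p in bad i | val p.2 - val p.1 == d].
exists (fun i => [fset d in D i | (#|B i d|%:R : R) <= theta * #|{: V}|%:R]); split.
- by move=> i; apply: fset_sub.
- move=> i im; set X := _ `\` _.
  have lt d : d \in X -> theta * #|{: V}|%:R < #|B i d|%:R.
    by rewrite !inE /= ltNge => /andP[+ dD]; rewrite dD.
  have le : #|` X|%:R * (theta * #|{: V}|%:R) <= eps * theta * #|{: V}|%:R ^+ 2.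
    apply: le_trans (cE' i im); apply: (@le_trans _ _ (\sum_(d <- X) #|B i d|)%:R).
      rewrite -sum1_size !natr_sum mulr_suml big_seq [leRHS]big_seq.
      by apply: ler_sum => d /lt /ltW; rewrite mul1r.
    by rewrite ler_nat; apply: sum_card_fibres.
  have [V0|Vn0] := posnP #|{: V}|.
    suff -> : X = fset0 by rewrite cardfs0 mulr_ge0 // ltW.
    apply/fsetP => d; rewrite [RHS]inE; apply/negP => /lt; rewrite V0 mulr0.
    rewrite ltNge lern0 -leqn0 => /negP; apply.
    by apply: leq_trans (max_card _) _; rewrite card_prod V0.
  move: le; rewrite [eps * theta]mulrC expr2 mulrCA -!mulrA ler_pM2l //.
  by rewrite !mulrA ler_pM2r // ltr0n.
move=> d Z dD d1 ZV.
pose s j : G := \sum_(i < j) d i.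
have s0 : s 0%N = 0 by rewrite /s big_ord0.
have ZV' (z : Z) j : (j <= m.+3)%N -> val z + s j \in V.
  rewrite leq_eqVlt => /orP[/eqP ->|]; last by apply: ZV; apply: valP.
  by rewrite /s d1 -s0; apply: ZV => //; apply: valP.
(* The default is the starting vertex; it can occur only for [j] beyond [m.+3]. *)
pose v (z : Z) j : V := insubd [` ZV' z 0%N isT] (val z + s j).
have vE z j : (j <= m.+3)%N -> val (v z j) = val z + s j.
  by move=> jm; rewrite val_insubd ZV'.
have vB z (i : 'I_m.+3) : val (v z i.+1) - val (v z i) = d i.
  rewrite !vE ?(ltnW (ltn_ord i)) // /s big_ord_recr /= addrA [LHS]addrC.
  by rewrite addrA addNr add0r.
have hit (z : Z) : exists i : 'I_m.+3, (v z i, v z i.+1) \in B i (d i).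
  apply/existsP; apply: contraT => nex; case: (nE' (v z)).
    by apply: val_inj; rewrite !vE // s0 /s d1.
  move=> i im; move: nex; rewrite negb_exists => /forallP/(_ (Ordinal im)).
  rewrite !inE /= (vB z (Ordinal im)) eqxx andbT negb_and negbK => /orP[|//].
  by rewrite /cayley (vB z (Ordinal im)) => /negP[]; have := dD i im; rewrite !inE => /andP[].
apply: (@le_trans _ _ (\sum_(i < m.+3) #|B i (d i)|)%:R); last first.
  rewrite natr_sum mulr_natl -[X in _ *+ X]card_ord -sumr_const; apply: ler_sum => i _.
  by have := dD i (ltn_ord i); rewrite !inE => /andP[].
rewrite ler_nat cardfE -sum1_card.
apply: (@leq_trans (\sum_(z : Z) \sum_(i < m.+3) ((v z i, v z i.+1) \in B i (d i)))).
  apply: leq_sum => z _; have [i zi] := hit z.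
  by rewrite (bigD1 i) //= zi.
rewrite exchange_big /=; apply: leq_sum => i _.
rewrite -big_mkcond /= sum1_card.
have inj : injective (fun z : Z => (v z i, v z i.+1)).
  move=> z w [/(congr1 val)]; rewrite !vE ?(ltnW (ltn_ord i)) // => /addIr /val_inj //.
rewrite -(card_image inj); apply: subset_leq_card; apply/subsetP => p.
by case/imageP => z zB ->.
Qed.

(** * Popular elements *)

(* [(x - y, b)] is encoded by [(x + b, y + b)]. *)
Lemma ruzsa_difference (G : zmodType) (X B : {fset G}) :
  (#|` [fset (x - y)%R | x in X, y in X]| * #|` B| <= #|` addfset X B| ^ 2)%N.
Proof.
set D := [fset x - y | x in X, y in X].
have : forall z : D, exists p : G * G, [/\ p.1 \in X, p.2 \in X & val z = p.1 - p.2].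
  move=> [z /= zD]; have /imfset2P[x /= xX [y /= yX ->]] := zD.
  by exists (x, y).
move=> /fin_all_exists[f fP].
have H1 (p : D * B) : (f p.1).1 + val p.2 \in addfset X B.
  have [? _ _] := fP p.1; apply/imfset2P; exists (f p.1).1 => //.
  by exists (val p.2) => //; apply: valP.
have H2 (p : D * B) : (f p.1).2 + val p.2 \in addfset X B.
  have [_ ? _] := fP p.1; apply/imfset2P; exists (f p.1).2 => //.
  by exists (val p.2) => //; apply: valP.
rewrite !cardfE -card_prod expnS expn1 -card_prod.
apply: (leq_card (fun p => ([` H1 p], [` H2 p]))) => -[z b] [z' b'] /= [e1 e2].
have zz : z = z'.
  apply: val_inj; have [_ _ ->] := fP z; have [_ _ ->] := fP z'.
  have shift (x y c : G) : x - y = (x + c) - (y + c).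
    by rewrite opprD addrACA subrr addr0.
  by rewrite (shift (f z).1 _ (val b)) e1 e2 -shift.
rewrite zz in e1 *; congr (_, _); apply: val_inj; exact: addrI e1.
Qed.

(** Fixing an element of every other summand embeds a translate of [A i]. *)
Lemma leq_card_sumset (G : zmodType) (r : nat) (A : 'I_r -> {fset G}) (i : 'I_r) :
  (forall j, A j != fset0) -> (#|` A i| <= #|` sumset A|)%N.
Proof.
move=> An0; have : forall j, exists x, x \in A j by move=> j; apply/fset0Pn.
move=> /fin_all_exists[c cA].
pose s := \sum_(j < r | j != i) c j.
have <- : #|` [fset x + s | x in A i]| = #|` A i| by rewrite card_imfset //; apply: addIr.
apply: fsubset_leq_card; apply/fsubsetP => _ /imfsetP[x /= xA ->].
apply/sumsetP; exists [ffun j => if j == i then x else c j].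
  by move=> j; rewrite ffunE; case: eqP => [->|].
rewrite (bigD1 i) //= ffunE eqxx; congr (_ + _); apply: eq_bigr => j /negPf ji.
by rewrite ffunE ji.
Qed.

Section Popular.
Variables (R : realType) (G : zmodType) (r : nat) (T : finType).
Variables (e : 'I_r -> T -> G) (H : {set {ffun 'I_r -> T}}).
Hypothesis e_inj : forall i, injective (e i).

Definition update (b : {ffun 'I_r -> T}) (i : 'I_r) (t : T) : {ffun 'I_r -> T} :=
  [ffun j => if j == i then t else b j].

Definition tuple_sum (f : {ffun 'I_r -> T}) : G := \sum_(i < r) e i (f i).

Lemma tuple_sum_update b i t :
  tuple_sum (update b i t) = tuple_sum b - e i (b i) + e i t.
Proof.
rewrite /tuple_sum (bigD1 i) //= [in RHS](bigD1 i) //= ffunE eqxx.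
rewrite [e i (b i) + _]addrC addrK addrC; congr (_ + _).
by apply: eq_bigr => j /negPf ji; rewrite ffunE ji.
Qed.

(** At most [g * #|T| ^ (r - 1)] non-edges pass through [t]; the extra factor [#|T|] avoids the
    subtraction. *)
Definition popular (g : R) (i : 'I_r) : {set T} :=
  [set t | #|T|%:R * #|[set f in ~: H | f i == t]|%:R <= g * #|T|%:R ^+ r].

(** Markov's inequality, sorting the non-edges by their [i]-th entry. *)
Lemma card_unpopular g i :
  g * #|T|%:R ^+ r * #|~: popular g i|%:R <= #|T|%:R * #|~: H|%:R.
Proof.
have -> : #|~: H| = (\sum_t \sum_(f in ~: H | f i == t) 1)%N.
  by rewrite -sum1_card (partition_big (fun f : {ffun 'I_r -> T} => f i) xpredT).
rewrite [leLHS]mulr_natr -sumr_const natr_sum mulr_sumr [leLHS]big_mkcond; apply: ler_sum => t _.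
have -> : (\sum_(f in ~: H | f i == t) 1)%N = #|[set f in ~: H | f i == t]|.
  by rewrite -sum1_card; apply: eq_bigl => f; rewrite !inE.
case: ifP => [|_]; last by rewrite -natrM.
by rewrite !inE -ltNge => /ltW.
Qed.

(** The tuple [b] is recovered from the overwritten entry [b i] and the updated tuple, a non-edge
    through [t]. *)
Lemma card_update_notin g i t : t \in popular g i ->
  #|[set b | update b i t \notin H]|%:R <= g * #|T|%:R ^+ r.
Proof.
rewrite inE; apply: le_trans; rewrite -natrM ler_nat -cardsT -cardsX.
rewrite -(card_in_imset (f := fun b : {ffun 'I_r -> T} => (b i, update b i t))); last first.
  move=> b b' _ _ [bi /ffunP u]; apply/ffunP => j; have := u j; rewrite !ffunE.
  by case: eqP => [-> _|].
apply: subset_leq_card; apply/subsetP => _ /imsetP[b + ->].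
by rewrite !inE ffunE eqxx => ->; rewrite eqxx.
Qed.

Definition good_for (a : {ffun 'I_r -> T}) : {set {ffun 'I_r -> T}} :=
  [set b in H | [forall i, update b i (a i) \in H]].

(** Union bound over [b] and its [r] updates. *)
Lemma card_good_for g (a : {ffun 'I_r -> T}) : (forall i, a i \in popular g i) ->
  #|T|%:R ^+ r - #|~: H|%:R - r%:R * (g * #|T|%:R ^+ r) <= #|good_for a|%:R.
Proof.
move=> aP.
have cT : #|T|%:R ^+ r = #|good_for a|%:R + #|~: good_for a|%:R :> R.
  by rewrite -natrD cardsC card_ffun card_ord natrX.
suff : #|~: good_for a|%:R <= #|~: H|%:R + r%:R * (g * #|T|%:R ^+ r).
  rewrite cT; lra.
apply: (@le_trans _ _ (#|~: H|%:R
     + \sum_(i < r) #|[set b | update b i (a i) \notin H]|%:R)); last first.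
  rewrite lerD2l mulr_natl -[X in _ *+ X]card_ord -sumr_const.
  by apply: ler_sum => i _; apply: card_update_notin.
rewrite -natr_sum -natrD ler_nat -!sum1_card [X in (X <= _)%N]big_mkcond /=.
rewrite [X in (_ <= X + _)%N]big_mkcond /=.
under [X in (_ <= _ + X)%N]eq_bigr => i _ do rewrite -sum1_card big_mkcond /=.
rewrite [X in (_ <= _ + X)%N]exchange_big /= -big_split /=.
apply: leq_sum => b _; rewrite !inE; case: (b \in H) => //=.
case: forallP => // /forallP; rewrite negb_forall => /existsP[i bi].
by rewrite (bigD1 i) //= inE bi.
Qed.

(** Fix one representation [al x] of each [x] in the sumset. Sending [x] and a tuple [b] good for
    [al x] to the sums of [b] and of its [r] updates is an injection into [r.+1] copies of [S]. *)
Lemma popular_sumset_card (P : 'I_r -> {set T}) (S : {fset G}) (h : R) :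
    (forall f, f \in H -> tuple_sum f \in S) ->
    (forall a : {ffun 'I_r -> T}, (forall i, a i \in P i) -> h <= #|good_for a|%:R) ->
  #|` sumset (fun i => [fset e i t | t in P i])|%:R * h <= #|` S|%:R ^+ r.+1.
Proof.
move=> HS Hh; set W := sumset _.
have : forall x : W, exists a : {ffun 'I_r -> T},
    (forall i, a i \in P i) /\ val x = tuple_sum a.
  move=> [x /= /sumsetP[a aA ->]].
  have : forall i, exists t, t \in P i /\ a i = e i t.
    by move=> i; have /imfsetP[t /= tP ->] := aA i; exists t.
  move=> /fin_all_exists[f fP]; exists [ffun i => f i]; split=> [i|].
    by rewrite ffunE; have [] := fP i.
  by apply: eq_bigr => i _; rewrite ffunE; have [] := fP i.
move=> /fin_all_exists[al alP].
pose Om := [pred p : W * {ffun 'I_r -> T} | p.2 \in good_for (al p.1)].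
have cOm : #|` W|%:R * h <= #|Om|%:R.
  rewrite -sum1_card natr_sum -(pair_big_dep xpredT
    (fun x b => b \in good_for (al x)) (fun _ _ => 1)) /=.
  rewrite cardfE mulr_natl -sumr_const; apply: ler_sum => x _.
  by rewrite sumr_const -[leRHS]/(_%:R); apply: Hh; have [] := alP x.
apply: le_trans cOm _; rewrite -natrX ler_nat -card_sig.
have H0 (p : {p | Om p}) : tuple_sum (val p).2 \in S.
  by apply: HS; have := valP p; rewrite inE inE => /andP[].
have Hi (p : {p | Om p}) i : tuple_sum (update (val p).2 i (al (val p).1 i)) \in S.
  by apply: HS; have := valP p; rewrite inE inE => /andP[_ /forallP].
rewrite expnS cardfE -[X in (_ ^ X)%N]card_ord -card_ffun -card_prod.
apply: (leq_card (fun p => ([` H0 p], [ffun i => [` Hi p i]]))).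
move=> p q [e0 /ffunP e1]; apply: val_inj.
have {}e1 i : tuple_sum (update (val p).2 i (al (val p).1 i)) =
              tuple_sum (update (val q).2 i (al (val q).1 i)).
  by have := congr1 val (e1 i); rewrite !ffunE.
case: p q e0 e1 {H0 Hi} => [[x b] /= xb] [[x' b'] /= xb'] e0 e1.
(* Updated sum minus original sum. Adding over [i] recovers [x]; then each [b i] follows by
   [e_inj]. *)
have e2 i : e i (al x i) - e i (b i) = e i (al x' i) - e i (b' i).
  have := e1 i; rewrite !tuple_sum_update -!addrA e0 => /addrI.
  by rewrite ![- _ + _]addrC.
have xx : x = x'.
  apply: val_inj; have [_ ->] := alP x; have [_ ->] := alP x'.
  apply: (addIr (- tuple_sum b)); rewrite [in RHS]e0 /tuple_sum -!sumrB.
  by apply: eq_bigr => i _.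
rewrite xx in e2 *; congr (_, _); apply/ffunP => i.
by apply: (@e_inj i); have /addrI/oppr_inj := e2 i.
Qed.

End Popular.

(** * Counting walks by solutions *)

Section CayleyCount.
Variables (R : realType) (G : zmodType) (T : finType).
Variables (e : nat -> T -> G) (P : nat -> {set T}).

Definition ffun_rcons (m : nat) (f : {ffun 'I_m -> T}) (t : T) :
    {ffun 'I_m.+1 -> T} := [ffun j => oapp f t (unlift ord_max j)].

Definition solutions (m : nat) (x : G) : {set {ffun 'I_m -> T}} :=
  [set f : {ffun 'I_m -> T} | [forall j, f j \in P j]
     & \sum_(j < m) e j (f j) == x].

Lemma ffun_rcons_inj m (f f' : {ffun 'I_m -> T}) t t' :
  ffun_rcons f t = ffun_rcons f' t' -> f = f' /\ t = t'.
Proof.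
move=> /ffunP E; split; last by have := E ord_max; rewrite !ffunE unlift_none.
by apply/ffunP => j; have := E (lift ord_max j); rewrite !ffunE liftK.
Qed.

Lemma solutions_rcons m x t f :
  f \in solutions m x -> t \in P m -> ffun_rcons f t \in solutions m.+1 (x + e m t).
Proof.
rewrite !inE => /andP[/forallP fP /eqP <-] tP; apply/andP; split.
  apply/forallP => j; rewrite ffunE; case: unliftP => [i|] ->; last exact: tP.
  by rewrite lift_max; apply: fP.
rewrite big_ord_recr /= ffunE unlift_none /=; apply/eqP; congr (_ + _).
apply: eq_bigr => j _; congr (e j _).
have -> : widen_ord (leqnSn m) j = lift ord_max j by apply: ord_inj; rewrite lift_max.
by rewrite ffunE liftK.
Qed.

(** Given [u], a walk is determined by the labels of its steps, which sum to [val w - val u]; the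
    induction appends the last label. *)
Lemma walks_solutions (V : {fset G}) (D : nat -> {fset G}) (m : nat) (u w : V) :
    (forall i, (i < m)%N -> D i = [fset e i t | t in P i]) ->
  walks R (cayley V D) m 0 u w <= #|solutions m (val w - val u)|%:R.
Proof.
elim: m w => [|m IH] w DE.
  rewrite /= ler_nat; case: eqP => // <-; apply/card_gt0P.
  exists (ffun0 (card_ord 0)).
  rewrite inE big_ord0 subrr eqxx andbT; apply/forallP; by case.
rewrite walks_recr add0n.
pose B (v : V) := [set t in P m | e m t == val w - val v].
apply: (@le_trans _ _ (\sum_v #|solutions m (val v - val u)| * #|B v|)%:R).
  rewrite natr_sum; apply: ler_sum => v _; rewrite natrM; apply: ler_pM => //.
  - exact: walks_ge0.
  - by apply: IH => i im; apply: DE; apply: ltnW.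
  rewrite /cayley DE // ler_nat.
  case: imfsetP => //= -[t tP wv]; apply/card_gt0P; exists t.
  by rewrite inE tP wv eqxx.
rewrite ler_nat.
under eq_bigr => v _ do rewrite -cardsX -sum1_card.
rewrite pair_big_dep /=.
pose Om := [set q : V * ({ffun 'I_m -> T} * T) |
  (q.2.1 \in solutions m (val q.1 - val u)) && (q.2.2 \in B q.1)].
rewrite (eq_bigl (mem Om)); last by move=> [v [f t]]; rewrite !inE.
rewrite sum1_card.
pose F (q : V * ({ffun 'I_m -> T} * T)) := ffun_rcons q.2.1 q.2.2.
rewrite -(card_in_imset (f := F)).
  apply: subset_leq_card; apply/subsetP => _ /imsetP[[v [f t]] + ->].
  rewrite inE [_ \in solutions _ _]inE [_ \in B _]inE /=.
  move=> /andP[/andP[fP /eqP fv] /andP[tP /eqP tv]].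
  have -> : val w - val u = (val v - val u) + e m t by rewrite tv [RHS]addrC subrKA.
  by apply: solutions_rcons => //; rewrite inE fP fv eqxx.
move=> [v [f t]] [v' [f' t']]; rewrite !inE /=.
move=> /andP[/andP[_ /eqP fv] _] /andP[/andP[_ /eqP fv'] _] /ffun_rcons_inj /= [ff ->].
by rewrite -ff fv in fv' *; have /addIr/val_inj -> := fv'.
Qed.

(** The closing step has a label [- x] with [x] in [X], so the first [m] labels sum to [x]; with the
    start [u] they determine the closed walk. *)
Lemma closed_walks_cayley (V : {fset G}) (D : nat -> {fset G}) (m : nat)
    (X : {fset G}) :
    (forall i, (i < m)%N -> D i = [fset e i t | t in P i]) ->
    D m = [fset - x | x in X] ->
  \sum_u walks R (cayley V D) m.+1 0 u u <= #|` V|%:R *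
    #|[set f : {ffun 'I_m -> T} | [forall j, f j \in P j]
         & \sum_(j < m) e j (f j) \in X]|%:R.
Proof.
move=> DE DX; set S := [set f | _ & _].
rewrite cardfE mulr_natl -sumr_const; apply: ler_sum => u _.
rewrite walks_recr add0n.
pose s (f : {ffun 'I_m -> T}) := val u + \sum_(j < m) e j (f j).
apply: (@le_trans _ _ (\sum_(d <- V) #|[set f in S | s f == d]|)%:R); last first.
  by rewrite ler_nat; apply: sum_card_fibres.
rewrite big_seq_fsetE natr_sum; apply: ler_sum => v _.
rewrite /cayley DX; case: imfsetP => [[x /= xX ux]|_]; last by rewrite mulr0.
rewrite mulr1; apply: le_trans (walks_solutions _ _ DE) _; rewrite ler_nat.
apply: subset_leq_card; apply/subsetP => f; rewrite !inE /s => /andP[-> /eqP ->].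
have vu : val v - val u = x by rewrite -opprB ux opprK.
by rewrite vu xX -vu [val u + _]addrC subrK eqxx.
Qed.

End CayleyCount.

(* Completing a partial sum [u + a_1 + ... + a_(j-1)] by the fixed terms [c i],
   [j <= i], lands in [sumset A]; hence the translates. *)
Definition walk_vertices (G : zmodType) (m : nat) (A : 'I_m.+2 -> {fset G})
    (c : 'I_m.+2 -> G) : {fset G} :=
  [fset x - y | x in A ord0, y in A ord0] `|`
  [fset val p.1 - \sum_(i < m.+2 | (nat_of_ord p.2 <= i)%N) c i | p : sumset A * 'I_m.+3].

Lemma card_walk_vertices (G : zmodType) (m : nat) (A : 'I_m.+2 -> {fset G})
    (c : 'I_m.+2 -> G) :
  (#|` walk_vertices A c| <= #|` [fset (x - y)%R | x in A ord0, y in A ord0]|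
                            + m.+3 * #|` sumset A|)%N.
Proof.
apply: leq_trans (leq_card_fsetU _ _) _; rewrite leq_add2l.
apply: leq_trans (leq_imfset_card _ _ _) _.
by rewrite -cardE card_prod card_ord -cardfE mulnC.
Qed.

(** For [j = 0] the vertex is the difference [u - d 0]. For [j > 0] the term [d 0] cancels, and the
    tuple with [u] in place 0, then [d i] for [i < j] and [c i] for [j <= i], gives an element of
    the sumset. *)
Lemma walk_vertices_mem (G : zmodType) (m : nat) (A : 'I_m.+2 -> {fset G})
    (c : 'I_m.+2 -> G) (d : nat -> G) (u : G) (j : nat) :
    (forall i, c i \in A i) -> (forall i : 'I_m.+2, d i \in A i) ->
    u \in A ord0 -> (j < m.+3)%N ->
  u - d 0%N + \sum_(i < j) d i \in walk_vertices A c.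
Proof.
move=> cA dA uA jm; rewrite inE; apply/orP; case: j jm => [|j] jm.
  left; rewrite big_ord0 addr0; apply/imfset2P; exists u => //.
  by exists (d 0%N) => //; apply: (dA ord0).
right; pose b : {ffun 'I_m.+2 -> G} :=
  [ffun i : 'I_m.+2 => if i == ord0 then u else if (i <= j)%N then d i else c i].
have bA : \sum_i b i \in sumset A.
  apply/sumsetP; exists b => // i; rewrite ffunE; case: eqP => [-> //|_].
  by case: ifP.
apply/imfsetP; exists ([` bA], Ordinal jm) => //=.
apply: (canRL (addrK _)).
rewrite (big_ord_widen m.+2 d) // [RHS](bigID (fun i : 'I_m.+2 => (i <= j)%N)) /=.
congr (_ + _).
  rewrite (bigD1 ord0) //= [in RHS](bigD1 ord0) //= ffunE eqxx addrA subrK.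
  congr (_ + _); apply: eq_bigr => i /andP[ij /negPf i0].
  by rewrite ffunE i0 -ltnS ij.
apply: eq_big => [i|i]; first by rewrite ltnNge.
move=> ji; rewrite ffunE leqNgt ji /=; case: eqP ji => // ->.
by rewrite ltn0.
Qed.

(** * Enumeration of the sets [A i] by the common type ['I_n] *)

Section Indexing.
Variables (G : zmodType) (r n : nat) (A : 'I_r -> {fset G}).
Hypothesis cA : forall i, #|` A i| = n.

Definition elt (i : 'I_r) (t : 'I_n) : G := nth 0 (enum_fset (A i)) t.

Lemma elt_inj i : injective (elt i).
Proof.
move=> s t /eqP; rewrite nth_uniq ?fset_uniq //; first by move/eqP/val_inj.
  by rewrite -[X in (_ < X)%N]/#|` A i| cA.
by rewrite -[X in (_ < X)%N]/#|` A i| cA.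
Qed.

Lemma elt_mem i t : elt i t \in A i.
Proof. by apply: mem_nth; rewrite -[X in (_ < X)%N]/#|` A i| cA. Qed.

Lemma elt_surj i x : x \in A i -> exists t, x = elt i t.
Proof.
move=> xA; have lt : (index x (enum_fset (A i)) < n)%N by rewrite -(cA i) index_mem.
by exists (Ordinal lt); rewrite /elt nth_index.
Qed.

Definition index_graph (H : {fset {ffun 'I_r -> G}}) : {set {ffun 'I_r -> 'I_n}} :=
  [set f : {ffun 'I_r -> 'I_n} | [ffun i => elt i (f i)] \in H].

Lemma card_index_graph H : partite_hypergraph A H ->
  (#|` H| <= #|index_graph H|)%N.
Proof.
move=> HA; rewrite cardE.
pose phi (f : {ffun 'I_r -> 'I_n}) : {ffun 'I_r -> G} := [ffun i => elt i (f i)].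
apply: leq_trans (leq_imfset_card imfset_key phi (mem (index_graph H))).
apply: fsubset_leq_card; apply/fsubsetP => a aH.
have : forall i, exists t, a i = elt i t by move=> i; apply: elt_surj; apply: HA.
move=> /fin_all_exists[f fa].
have aE : a = phi [ffun i => f i] by apply/ffunP => i; rewrite !ffunE.
by apply/imfsetP; exists [ffun i => f i] => //=; rewrite inE -/(phi _) -aE.
Qed.

End Indexing.

(** * Choice of the constants and construction of the sets [A'] *)

Theorem theorem1p5 (R : realType) (eps C : R) (r : nat)
    (heps0 : 0 < eps) (heps : eps < 1 / 2) (hC : 1 < C) (hr : (2 <= r)%N) :
  exists delta : R, 0 < delta /\
    forall (G : zmodType) (n : nat) (A : 'I_r -> {fset G})
           (H : {fset {ffun 'I_r -> G}}),
      (forall i : 'I_r, #|` A i| = n) ->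
      partite_hypergraph A H ->
      (1 - delta) * n%:R ^+ r <= (#|` H|)%:R ->
      (#|` hypergraph_sum H|)%:R <= C * n%:R ->
      exists A' : 'I_r -> {fset G},
        [/\ forall i : 'I_r, A' i `<=` A i,
            forall i : 'I_r, (1 - eps) * n%:R <= (#|` A' i|)%:R
          & (#|` sumset A'|)%:R <= (C + eps) * n%:R].
Proof.
case: r hr => [//|[//|m]] _; set r := m.+2.
(* The updates in [card_good_for] cost [r * g = 1 / 4]; with [delta <= 1 / 4], half of the tuples
   stay good. *)
pose g : R := (4 * r%:R)^-1.
(* [K * n] bounds the popular sumset [W], and [L * n] the vertex set: [2 * K ^+ 2] for the
   differences, [r.+1%:R * K] for the translates of [W]. *)
pose K : R := 2 * C ^+ r.+1.
pose L : R := 2 * K ^+ 2 + r.+1%:R * K.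
(* A surviving solution would force [A1 ord0] to have at most [r.+1 * theta * L * n = n / 2]
   elements, which is too few. *)
pose theta : R := (2 * r.+1%:R * L)^-1.
have K0 : 0 < K by apply: mulr_gt0 => //; apply: exprn_gt0; lra.
have L0 : 0 < L.
  by apply: addr_gt0; apply: mulr_gt0 => //; apply: exprn_gt0.
have g0 : 0 < g by rewrite invr_gt0 mulr_gt0 ?ltr0n.
have rg : r%:R * g = 1 / 4 by rewrite /g invfM mulrCA divff ?pnatr_eq0 // mulr1 mul1r.
have th0 : 0 < theta by rewrite invr_gt0 !mulr_gt0 ?ltr0n.
have thL : r.+1%:R * (theta * L) = 1 / 2.
  have k0 : r.+1%:R != 0 :> R by rewrite pnatr_eq0.
  by rewrite /theta; field; rewrite k0 gt_eqF.
have e20 : 0 < eps / (2 * L) by rewrite divr_gt0 // mulr_gt0.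
have [d5 d50 rem] := cayley_removal m e20 th0.
(* In order: half of the tuples are good; at most [eps / 2 * n] elements of each set are unpopular;
   there are few closed walks, where [2 ^+ r] appears because [V] has at least [n / 2] vertices. *)
pose delta : R := Num.min (1 / 4) (Num.min (g * eps / 2) (d5 / 2 ^+ r)).
have dl0 : 0 < delta.
  rewrite !lt_min; apply/and3P; split; first lra.
    by rewrite divr_gt0 // mulr_gt0.
  by rewrite divr_gt0 // exprn_gt0.
have dl1 : delta <= 1 / 4 by rewrite ge_min lexx.
have dl2 : delta <= g * eps / 2 by rewrite !ge_min lexx orbT.
have dl3 : delta <= d5 / 2 ^+ r by rewrite !ge_min lexx !orbT.
exists delta; split=> // G n A H cA HA Hd HS.
have [n0|n_gt0] := posnP n.
  have A0 i : A i = fset0 by apply/eqP; rewrite -cardfs_eq0 cA n0.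
  exists A; split=> //; first by move=> i; rewrite cA n0 mulr0.
  suff -> : sumset A = fset0 by rewrite cardfs0 n0 mulr0.
  by apply/fsetP => x; rewrite [RHS]inE; apply/sumsetP => -[a /(_ ord0)]; rewrite A0 inE.
have N0 : 0 < n%:R :> R by rewrite ltr0n.
set N : R := n%:R in Hd HS N0 *.
pose e := @elt G r n A; pose Hb : {set {ffun 'I_r -> 'I_n}} := @index_graph G r n A H.
pose P i := popular Hb g i.
have cN : #|'I_n|%:R = N by rewrite card_ord.
have cHb : #|~: Hb|%:R <= delta * N ^+ r.
  have : N ^+ r = #|Hb|%:R + #|~: Hb|%:R by rewrite -natrD cardsC card_ffun !card_ord natrX.
  have := card_index_graph cA HA; rewrite -(ler_nat R) -/Hb; move: Hd; lra.
have cPC i : #|~: P i|%:R <= eps / 2 * N.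
  have := card_unpopular Hb g i; rewrite cN -/(P i) => le.
  have : g * N ^+ r * #|~: P i|%:R <= g * N ^+ r * (eps / 2 * N).
    apply: le_trans le _; have -> : g * N ^+ r * (eps / 2 * N) = N * (g * eps / 2 * N ^+ r) by ring.
    rewrite ler_pM2l //; apply: le_trans cHb _; rewrite ler_pM2r // exprn_gt0 //.
  by rewrite ler_pM2l // mulr_gt0 // exprn_gt0.
have cP i : (1 - eps / 2) * N <= #|P i|%:R.
  have : N = #|P i|%:R + #|~: P i|%:R by rewrite -natrD cardsC card_ord.
  have := cPC i; lra.
pose A1 i := [fset e i t | t in P i].
have cA1 i : #|` A1 i| = #|P i|.
  by rewrite cardE; apply: card_imfset; apply: elt_inj.
have A1n i : N / 2 <= #|` A1 i|%:R.
  rewrite cA1; apply: le_trans (cP i); rewrite mulrC ler_pM2r //; lra.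
have A1_neq0 i : A1 i != fset0.
  by rewrite -cardfs_gt0 -(ltr_nat R); apply: lt_le_trans (A1n i); rewrite divr_gt0.
set S := hypergraph_sum H in HS *.
have HbS f : f \in Hb -> tuple_sum e f \in S.
  rewrite inE => fH; apply/imfsetP; exists [ffun i => e i (f i)] => //.
  by apply: eq_bigr => i _; rewrite ffunE.
pose W := sumset A1.
have cW : #|` W|%:R <= K * N.
  have good (a : {ffun 'I_r -> 'I_n}) : (forall i, a i \in P i) ->
      N ^+ r / 2 <= #|good_for Hb a|%:R.
    move=> aP; apply: le_trans (card_good_for aP); rewrite cN mulrA rg.
    have : delta * N ^+ r <= 1 / 4 * N ^+ r by rewrite ler_pM2r // exprn_gt0.
    move: cHb; lra.
  have := popular_sumset_card (@elt_inj _ _ _ _ cA) HbS good.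
  rewrite -/W => le.
  have Nr : 0 < N ^+ r / 2 by rewrite divr_gt0 // exprn_gt0.
  rewrite -(ler_pM2r Nr); apply: le_trans le _.
  apply: (@le_trans _ _ ((C * N) ^+ r.+1)).
    by apply: lerXn2r; rewrite ?nnegrE // mulr_ge0 ?(ltW N0) //; lra.
  rewrite exprMn /K [N ^+ r.+1]exprSr le_eqVlt; apply/orP; left; apply/eqP.
  by field.
have [c cA1c] : exists c : 'I_r -> G, forall i, c i \in A1 i.
  have : forall i, exists x, x \in A1 i by move=> i; apply/fset0Pn.
  by move=> /fin_all_exists.
pose V := walk_vertices A1 c.
(* Ruzsa's inequality with [B] the sum of the other sets; as [r >= 2], [B] has at least [n / 2]
   elements. *)
have cdiff : #|` [fset (x - y)%R | x in A1 ord0, y in A1 ord0]|%:R <= 2 * K ^+ 2 * N.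
  set Dif := [fset _ | _ in _, _ in _].
  pose B := sumset (fun i : 'I_m.+1 => A1 (lift ord0 i)).
  have cB : N / 2 <= #|` B|%:R.
    apply: le_trans (A1n (lift ord0 ord0)) _; rewrite ler_nat.
    exact: (leq_card_sumset ord0 (fun i : 'I_m.+1 => A1_neq0 (lift ord0 i))).
  have WE : W = addfset (A1 ord0) B by rewrite /W /sumset big_ord_recl.
  have := ruzsa_difference (A1 ord0) B; rewrite -WE -(ler_nat R) natrM natrX => le.
  have : #|` Dif|%:R * (N / 2) <= 2 * K ^+ 2 * N * (N / 2).
    apply: (@le_trans _ _ (#|` Dif|%:R * #|` B|%:R)); first exact: ler_wpM2l.
    apply: le_trans le _; have -> : 2 * K ^+ 2 * N * (N / 2) = (K * N) ^+ 2 by field.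
    by apply: lerXn2r; rewrite ?nnegrE // mulr_ge0 ?(ltW N0) ?(ltW K0).
  by rewrite ler_pM2r // divr_gt0.
have cV : #|` V|%:R <= L * N.
  have := card_walk_vertices A1 c; rewrite -(ler_nat R) natrD natrM -/V -/W => le.
  apply: le_trans le _; rewrite /L [leRHS]mulrDl; apply: lerD => //.
  by rewrite -mulrA; apply: ler_wpM2l.
have A1V u : u \in A1 ord0 -> u \in V.
  move=> uA; have dA (i : 'I_r) : c (inord i) \in A1 i by rewrite inord_val.
  have := @walk_vertices_mem G m A1 c (fun i => c (inord i)) u 1 cA1c dA uA isT.
  by rewrite big_ord1 subrK.
have Vn : N / 2 <= #|` V|%:R.
  apply: le_trans (A1n ord0) _; rewrite ler_nat; apply: fsubset_leq_card.
  exact/fsubsetP.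
pose X := W `\` S.
(* With [- X] as closing labels, the solutions with sum in [X] become zero-sum sequences. *)
pose D i := if (i < r)%N then A1 (inord i) else [fset - x | x in X].
have DE i : (i < r)%N -> D i = [fset e (inord i) t | t in P (inord i)].
  by rewrite /D => ->.
have DX : D r = [fset - x | x in X] by rewrite /D ltnn.
have cl : \sum_u walks R (cayley V D) m.+3 0 u u <= d5 * #|` V|%:R ^+ m.+3.
  apply: le_trans (closed_walks_cayley R V DE DX) _.
  rewrite -/r exprS mulrCA; apply: ler_wpM2l => //.
  (* A tuple whose sum lies in [X] misses [S], hence is a non-edge. *)
  apply: (@le_trans _ _ #|~: Hb|%:R).
    rewrite ler_nat; apply: subset_leq_card; apply/subsetP => f.
    rewrite !inE => /andP[_ /andP[fS _]]; apply: contra fS => fH.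
    have := HbS f; rewrite inE => /(_ fH); congr (_ \in S).
    by apply: eq_bigr => i _; rewrite inord_val.
  apply: le_trans cHb _; apply: (@le_trans _ _ (d5 / 2 ^+ r * N ^+ r)).
    by rewrite ler_pM2r // exprn_gt0.
  rewrite -mulrA ler_pM2l // mulrC -exprVn -exprMn.
  by apply: lerXn2r; rewrite ?nnegrE // ltW // divr_gt0.
have [D' [D'D cD' D'sol]] := rem G V D cl.
have cDD i : (i < m.+3)%N -> #|` D i `\` D' i|%:R <= eps / 2 * N.
  move=> /cD' /le_trans; apply.
  apply: (@le_trans _ _ (eps / (2 * L) * (L * N))).
    by rewrite ler_pM2l.
  rewrite le_eqVlt; apply/orP; left; apply/eqP; field; exact: lt0r_neq0.
have DA (i : 'I_r) : D i = A1 i by rewrite /D ltn_ord inord_val.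
exists (fun i => D' i); split.
- move=> i; apply: fsubset_trans (D'D i) _; rewrite DA; apply/fsubsetP => x.
  by case/imfsetP => t _ ->; apply: elt_mem.
(* Half of [eps] pays for unpopular elements, half for dropped labels. *)
- move=> i; have := cDD i (ltnW (ltn_ord i)); have := cP i; rewrite -cA1 -DA.
  have := cardfsID (D' i) (D i); rewrite (fsetIidPr (D'D i)) => <-; rewrite natrD; lra.
(* If a remaining sum [x] is outside [S], its label [- x] must have been dropped: otherwise the
   summands and [- x] form a surviving zero-sum sequence, with a closed walk from [u - d 0] for
   every [u] in [A1 ord0]. *)
have sub : sumset (fun i : 'I_r => D' i) `<=` S `|` [fset - y | y in D r `\` D' r].
  apply/fsubsetP => x /sumsetP[a aD xE]; rewrite inE.
  have [//|xS /=] := boolP (x \in S).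
  have aA1 i : a i \in A1 i by rewrite -DA; apply: (fsubsetP (D'D i)).
  have xX : x \in X by rewrite inE xS; apply/sumsetP; exists a.
  apply/imfsetP; exists (- x); last by rewrite opprK.
  rewrite inE /= DX; apply/andP; split; last by apply/imfsetP; exists x.
  apply/negP => xD'.
  pose d i := if (i < r)%N then a (inord i) else - x.
  have dE (i : 'I_r) : d i = a i by rewrite /d ltn_ord inord_val.
  pose Z := [fset u - d 0%N | u in A1 ord0].
  have cZ : #|` Z| = #|` A1 ord0| by rewrite card_imfset //; apply: addIr.
  have : #|` Z|%:R <= m.+3%:R * (theta * #|` V|%:R).
    apply: (D'sol d).
    - move=> i; rewrite ltnS leq_eqVlt => /orP[/eqP ->|im]; first by rewrite /d ltnn.
      by rewrite /d im; have := aD (inord i); rewrite inordK.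
    - rewrite big_ord_recr /= {2}/d ltnn xE.
      by rewrite (eq_bigr a) ?subrr // => i _; rewrite -dE.
    - move=> z j /imfsetP[u /= uA ->] jm; apply: walk_vertices_mem => // i.
      by rewrite dE.
  rewrite cZ cA1; apply/negP; rewrite -ltNge.
  apply: lt_le_trans (cP ord0).
  apply: (@le_lt_trans _ _ (1 / 2 * N)); last by rewrite ltr_pM2r //; lra.
  rewrite -thL -!mulrA ler_pM2l ?ltr0n // ler_pM2l //.
apply: (@le_trans _ _ (#|` S|%:R + #|` D r `\` D' r|%:R)).
  rewrite -natrD ler_nat; apply: leq_trans (fsubset_leq_card sub) _.
  apply: leq_trans (leq_card_fsetU _ _) _; rewrite leq_add2l.
  exact: leq_imfset_card.
have := cDD r (leqnn _); rewrite mulrDl.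
have : eps / 2 * N <= eps * N by rewrite ler_pM2r //; lra.
move: HS; lra.
Qed.
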